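(* Let $\mu$ be a Borel probability measure on the unit circle $\mathbb{T}$, and for $\beta\in\mathbb{C}$ with $|\beta|<1$ let $\hat U_\beta$ be the completely non-unitary contraction on $L^2(\mu)$ given by $$\hat U_\beta = M_\xi+(\beta-1)\,(\,\cdot\,,\bar\xi)_{L^2(\mu)}\,\mathbf{1}_\xi .$$ Let $\theta_\beta$ be its scalar characteristic function, i.e. the function on $\mathbb{D}$ determined by $\Theta_\beta(z)\bar\xi=\theta_\beta(z)\mathbf{1}_\xi$, where $\Theta_\beta$ is the characteristic operator function of $\hat U_\beta$. Then for all $|\beta|<1$ and $z\in\mathbb{D}$, $$\theta_\beta(z)=-\beta+z(1-|\beta|^2)\,\frac{K(\bar\xi\mu)(z)}{K\mu(z)-z\bar\beta\,K(\bar\xi\mu)(z)} .$$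
   Context: $\mathbb{D}$ is the open unit disc. In $L^2(\mu)$, $\xi$ denotes the independent variable, $M_\xi$ multiplication by $\xi$, $\bar\xi$ the function $\xi\mapsto\bar\xi$, and $\mathbf{1}_\xi$ the constant function $1$. For a contraction $X$ on a Hilbert space, put $D_X=(\mathbf{I}-X^*X)^{1/2}$ and $D_{X^*}=(\mathbf{I}-XX^* )^{1/2}$; the characteristic operator function of a cnu contraction $X$ is $z\mapsto\left(-X+zD_{X^*}(\mathbf{I}-zX^* )^{-1}D_X\right)|_{\operatorname{clos}\operatorname{ran}D_X}$, with values in the operators from $\operatorname{clos}\operatorname{ran}D_X$ to $\operatorname{clos}\operatorname{ran}D_{X^*}$. For $X=\hat U_\beta$, $|\beta|<1$, these spaces are $\operatorname{span}\{\bar\xi\}$ and $\operatorname{span}\{\mathbf{1}_\xi\}$. The Cauchy transform of $f\mu$, $f\in L^1(\mu)$, is $K(f\mu)(z)=\int_{\mathbb{T}}\frac{f(\xi)\,d\mu(\xi)}{1-\bar\xi z}$ for $z\in\mathbb{C}\setminus\mathbb{T}$, and $K\mu=K(1\cdot\mu)$. *)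

(* Defs.v *)
From HB Require Import structures.
From mathcomp Require Import all_boot all_order all_algebra.
From mathcomp Require Import complex ring.
From mathcomp Require Import all_classical all_reals all_analysis.
From mathcomp Require Import measurable_realfun.

Set Implicit Arguments.
Unset Strict Implicit.
Unset Printing Implicit Defensive.
Import Order.TTheory GRing.Theory Num.Theory.
Import numFieldNormedType.Exports.
Import ComplexField.Normc.

Local Open Scope classical_set_scope.
Local Open Scope complex_scope.
Local Open Scope ring_scope.

Section DotNorm.
Context {C : numClosedFieldType} {U : lmodType C} (dot : {dot U for Num.conj}).
Implicit Types u v : U.

Lemma dot_CauchySchwarz u v : `|dot u v| ^+ 2 <= dot u u * dot v v.
Proof.
have [->|v0] := eqVneq v 0; first by rewrite !linear0r normr0 expr0n.
have vv0 : 0 < dot v v by rewrite dnorm_gt0.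
have vvR : (dot v v)^* = dot v v by apply/CrealP/ger0_real/ltW.
have vvN0 : dot v v != 0 by rewrite gt_eqF.
have := dnorm_ge0 dot (u - (dot u v / dot v v) *: v).
rewrite dnormB /= dnormZ linearZr_LR /= !normCK.
move: (dot u u) (dot u v) (dot v v) vv0 vvR vvN0 => a b c c0 cR cN0.
have -> : (b / c)^* = b^* / c by rewrite rmorphM fmorphV /= cR.
have -> : (b^* / c * b)^* = b^* / c * b.
  by rewrite !rmorphM fmorphV /= conjCK cR mulrAC [b * _]mulrC mulrAC.
move=> h; have : 0 <= c * (a - b * b^* / c).
  apply: mulr_ge0; first exact: ltW.
  apply: le_trans h _; rewrite le_eqVlt; apply/orP; left; apply/eqP.
  by field.
by rewrite mulrBr mulrC [c * (_ / _)]mulrC divfK// subr_ge0.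
Qed.

Definition dot_norm u : C := sqrtC (dot u u).

Lemma dot_norm_sqr u : dot_norm u ^+ 2 = dot u u.
Proof. exact: sqrtCK. Qed.

Lemma dot_normD u v : dot_norm (u + v) <= dot_norm u + dot_norm v.
Proof.
rewrite -(@ler_pXn2r _ 2)// ?nnegrE ?addr_ge0 ?sqrt_dnorm_ge0//.
rewrite sqrrD !dot_norm_sqr dnormD /= [leRHS]addrAC lerD2l.
have CS : `|dot u v| <= dot_norm u * dot_norm v.
  rewrite -(@ler_pXn2r _ 2)// ?nnegrE ?mulr_ge0 ?sqrt_dnorm_ge0//.
  by rewrite exprMn !dot_norm_sqr dot_CauchySchwarz.
have dR : dot u v + (dot u v)^* \is Num.real.
  by apply/CrealP; rewrite rmorphD /= conjCK addrC.
apply: le_trans (real_ler_norm dR) _.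
by rewrite mulr2n (le_trans (ler_normD _ _))// norm_conjC lerD.
Qed.

Lemma dot_normZ (a : C) u : dot_norm (a *: u) = `|a| * dot_norm u.
Proof.
by rewrite /dot_norm dnormZ sqrtCM ?nnegrE ?exprn_ge0// sqrCK.
Qed.

Lemma dot_norm0_eq0 u : dot_norm u = 0 -> u = 0.
Proof. by move=> /eqP; rewrite sqrt_dnorm_eq0 => /eqP. Qed.

End DotNorm.

Section Operators.
Context {C : numClosedFieldType} {H : normedModType C}.
Variable dot : {dot H for Num.conj}.

(* [get] picks a witness of the set (here unique when it exists), with a
   default value when the set is empty. *)
Definition adjoint (X : H -> H) : {linear H -> H} :=
  get [set Y : {linear H -> H} |
    continuous Y /\ forall u v, dot (X u) v = dot u (Y v)].

(* Over a complex space [0 <= dot (S v) v] for all v forces S to be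
   self-adjoint, so S is the unique positive square root of A. *)
Definition psqrt (A : H -> H) : {linear H -> H} :=
  get [set S : {linear H -> H} |
    [/\ continuous S, forall v, 0 <= dot (S v) v & S \o S = A]].

Definition op_inverse (A : H -> H) : {linear H -> H} :=
  get [set B : {linear H -> H} | [/\ continuous B, cancel A B & cancel B A]].

Definition defect (X : H -> H) : {linear H -> H} :=
  psqrt (fun v => v - adjoint X (X v)).

Definition defect_adj (X : H -> H) : {linear H -> H} :=
  psqrt (fun v => v - X (adjoint X v)).

(* [defect X] is D_X, [defect_adj X] is D_{X^*} and [char_op_fun X z] is the
   value at z of the characteristic operator function, restricted to
   clos ran D_X. The formula itself does not involve complete
   non-unitarity; contractivity is what makes the square roots exist. *)
Definition char_op_fun (X : H -> H) (z : C) : closure (range (defect X)) -> H :=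
  sigL (closure (range (defect X))) (fun v =>
    - X v + z *: defect_adj X
              (op_inverse (fun w => w - z *: adjoint X w) (defect X v))).

End Operators.
Arguments char_op_fun {C H} dot X z v.

Section ComplexIntegral.
Context d (T : measurableType d) (R : realType).
Variable mu : {measure set T -> \bar R}.

Definition Cintegral (f : T -> R[i]) : R[i] :=
  (\int[mu]_x complex.Re (f x)) +i* (\int[mu]_x complex.Im (f x)).

Definition square_integrable (f : T -> R[i]) : Prop :=
  [/\ measurable_fun setT (fun x => complex.Re (f x)),
      measurable_fun setT (fun x => complex.Im (f x)) &
      (\int[mu]_x ((normc (f x)) ^+ 2)%:E < +oo)%E].

Definition sqint : {pred T -> R[i]^o} := fun f => `[< square_integrable f >].

End ComplexIntegral.

Section L2space.
Context d (T : measurableType d) (R : realType).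
Variable mu : {measure set T -> \bar R}.
Implicit Types f g : T -> R[i].

Let p2 : (1 <= 2%:E :> \bar R)%E. Proof. by rewrite lee1n. Qed.

Lemma normc_sqr (z : R[i]) : normc z ^+ 2 = complex.Re z ^+ 2 + complex.Im z ^+ 2.
Proof. by case: z => a b /=; rewrite sqr_sqrtr// addr_ge0 ?sqr_ge0. Qed.

Lemma Lfun2P (g : T -> R) : g \in Lfun mu 2%:E <->
  measurable_fun setT g /\ (\int[mu]_x ((g x) ^+ 2)%:E < +oo)%E.
Proof.
split.
  move=> /[dup] /Lfun2_integrable_sqr /integrableP[_].
  move=> g2; rewrite inE => /andP[+ _]; rewrite inE /= => mg; split => //.
  by move: g2; under eq_integral do rewrite /= ger0_norm ?sqr_ge0//.
move=> [mg g2]; rewrite inE; apply/andP; rewrite !inE /=; split => //.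
rewrite /finite_norm unlock poweR_lty//.
under eq_integral => x _.
  rewrite (_ : (`|(EFin \o g) x| `^ 2)%E = ((g x) ^+ 2)%:E); last first.
    by rewrite /= powR_mulrn// real_normK// num_real.
  over.
exact: g2.
Qed.

Lemma square_integrableP f : square_integrable mu f <->
  (fun x => complex.Re (f x)) \in Lfun mu 2%:E /\
  (fun x => complex.Im (f x)) \in Lfun mu 2%:E.
Proof.
have E x : ((normc (f x)) ^+ 2)%:E =
    (((complex.Re (f x)) ^+ 2)%:E + ((complex.Im (f x)) ^+ 2)%:E)%E.
  by rewrite normc_sqr.
split=> [[mr mi fi]|[/Lfun2P[mr ri] /Lfun2P[mi ii]]].
  move: fi; under eq_integral do rewrite E.
  rewrite ge0_integralD//=; last 4 first.
  - by move=> x _; rewrite lee_fin sqr_ge0.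
  - by apply/measurable_EFinP; apply: measurable_funX.
  - by move=> x _; rewrite lee_fin sqr_ge0.
  - by apply/measurable_EFinP; apply: measurable_funX.
  move=> fi; split; apply/Lfun2P; split => //; apply: le_lt_trans fi.
    by rewrite leeDl// integral_ge0// => x _; rewrite lee_fin sqr_ge0.
  by rewrite leeDr// integral_ge0// => x _; rewrite lee_fin sqr_ge0.
split => //; under eq_integral do rewrite E.
rewrite ge0_integralD//=; first by rewrite lte_add_pinfty.
- by move=> x _; rewrite lee_fin sqr_ge0.
- by apply/measurable_EFinP; apply: measurable_funX.
- by move=> x _; rewrite lee_fin sqr_ge0.
- by apply/measurable_EFinP; apply: measurable_funX.
Qed.

Lemma sqintE f : f \in sqint mu <-> square_integrable mu f.
Proof. by rewrite unfold_in; split => [/asboolP|/asboolP]. Qed.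

Lemma sqint_submod_closed : submod_closed (sqint mu).
Proof.
have LD (g h : T -> R) : g \in Lfun mu 2%:E -> h \in Lfun mu 2%:E ->
    (g + h) \in Lfun mu 2%:E by apply: (Lfun_addr_closed mu p2).2.
have LZ (a : R) (g : T -> R) : g \in Lfun mu 2%:E ->
    (a *: (g : T -> R^o)) \in Lfun mu 2%:E.
  move=> lg; suff -> : (a *: (g : T -> R^o)) = a \o* g.
    exact: (Lfun_scale a (ler1n R 2) lg).
  by apply/funext => x /=; rewrite fctE mulrC.
split.
  apply/sqintE/square_integrableP.
  by split; apply: (Lfun_addr_closed mu p2).1.
move=> a f g /sqintE/square_integrableP[fr fi] /sqintE/square_integrableP[gr gi].
apply/sqintE/square_integrableP; split.
  set h := (X in X \in _).
  suff -> : h = complex.Re a *: ((fun x => complex.Re (f x)) : T -> R^o) +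
                (- complex.Im a) *: ((fun x => complex.Im (f x)) : T -> R^o) +
                (fun x => complex.Re (g x)).
    by apply: (LD _ _ _ gr); apply: LD; exact: LZ.
  apply/funext => x; rewrite /h !fctE.
  by case: a (f x) (g x) {h} => [a b] [c e] [h k] /=; rewrite /GRing.scale /= mulNr.
set h := (X in X \in _).
suff -> : h = complex.Re a *: ((fun x => complex.Im (f x)) : T -> R^o) +
              complex.Im a *: ((fun x => complex.Re (f x)) : T -> R^o) +
              (fun x => complex.Im (g x)).
  by apply: (LD _ _ _ gi); apply: LD; exact: LZ.
apply/funext => x; rewrite /h !fctE.
by case: a (f x) (g x) {h} => [a b] [c e] [h k] /=.
Qed.

HB.instance Definition _ := GRing.isSubmodClosed.Build R[i] (T -> R[i]^o)
  (sqint mu) sqint_submod_closed.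

Definition L2fun := {f : T -> R[i]^o | f \in sqint mu}.

HB.instance Definition _ := SubChoice.on L2fun.
HB.instance Definition _ := [SubChoice_isSubLmodule of L2fun by <:].

Definition ae_null : {pred L2fun} :=
  fun u => `[< \forall x \ae mu, val u x = 0 >].

Lemma ae_nullP (f : L2fun) : f \in ae_null <-> \forall x \ae mu, val f x = 0.
Proof. by rewrite unfold_in; split => [/asboolP|/asboolP]. Qed.

Lemma ae_null_zmod_closed : zmod_closed ae_null.
Proof.
split; first by apply/ae_nullP; apply: aeW.
move=> f g /ae_nullP f0 /ae_nullP g0; apply/ae_nullP.
apply: filterS2 f0 g0 => x fx gx.
by have -> : val (f - g) x = val f x - val g x by []; rewrite fx gx subrr.
Qed.

HB.instance Definition _ := GRing.isZmodClosed.Build L2fun ae_null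
  ae_null_zmod_closed.

(* L^2(mu; C): square-integrable complex functions modulo equality a.e. *)
Definition L2 := Quotient.quot (ae_null : zmodClosed L2fun).

HB.instance Definition _ := GRing.Zmodule.on L2.
HB.instance Definition _ := Quotient.on L2.

Definition L2class (f : L2fun) : L2 := (\pi_(Quotient.quot ae_null) f)%qT.
Definition L2mk f (hf : f \in sqint mu) : L2 :=
  L2class (exist (fun g : T -> R[i]^o => g \in sqint mu) f hf).
Definition L2repr (u : L2) : L2fun := repr u.


Lemma L2reprK u : L2class (L2repr u) = u.
Proof. exact: reprK. Qed.

Lemma L2class_eqP (f g : L2fun) :
  L2class f = L2class g <-> \forall x \ae mu, val f x = val g x.
Proof.
have E : L2class f = L2class g <-> f - g \in ae_null.
  rewrite /L2class; split=> [/eqP|h]; last apply/eqP;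
  by rewrite -(Quotient.idealrBE (ae_null : zmodClosed L2fun)).
split=> [/E/ae_nullP fg|fg]; last apply/E/ae_nullP.
  apply: filterS fg => x.
  by have -> : val (f - g) x = val f x - val g x by []; move/eqP; rewrite subr_eq0 => /eqP.
apply: filterS fg => x fg.
by have -> : val (f - g) x = val f x - val g x by []; rewrite fg subrr.
Qed.

Lemma L2repr_class (f : L2fun) : \forall x \ae mu, val (L2repr (L2class f)) x = val f x.
Proof. by apply/L2class_eqP; rewrite L2reprK. Qed.

Lemma L2classD (f g : L2fun) : L2class (f + g) = L2class f + L2class g.
Proof. by rewrite /L2class piE. Qed.

Lemma L2class0 : L2class 0 = 0.
Proof. by rewrite /L2class piE. Qed.

Definition L2scale (a : R[i]) (u : L2) : L2 := L2class (a *: L2repr u).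

Lemma L2classZ a (f : L2fun) : L2class (a *: f) = L2scale a (L2class f).
Proof.
apply/L2class_eqP; apply: filterS (L2repr_class f) => x fx.
have -> : val (a *: f) x = a * val f x by [].
by have -> : val (a *: L2repr (L2class f)) x = a * val (L2repr (L2class f)) x by []; rewrite fx.
Qed.

Lemma L2scaleA a b (u : L2) : L2scale a (L2scale b u) = L2scale (a * b) u.
Proof. by rewrite -[u]L2reprK -!L2classZ scalerA. Qed.
Lemma L2scale1 : left_id 1 L2scale.
Proof. by move=> u; rewrite -[u]L2reprK -!L2classZ scale1r. Qed.
Lemma L2scaleDr : right_distributive L2scale +%R.
Proof.
by move=> a u v; rewrite -[u]L2reprK -[v]L2reprK -!(L2classZ, L2classD) scalerDr.
Qed.
Lemma L2scaleDl v : {morph L2scale^~ v : a b / a + b}.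
Proof.
by move=> a b; rewrite -[v]L2reprK -!(L2classZ, L2classD) scalerDl.
Qed.

HB.instance Definition _ := GRing.Zmodule_isLmodule.Build R[i] L2
  L2scaleA L2scale1 L2scaleDr L2scaleDl.

Definition Cintegrable f := mu.-integrable setT (EFin \o (fun x => complex.Re (f x)))
  /\ mu.-integrable setT (EFin \o (fun x => complex.Im (f x))).

Lemma CintegralD f g : Cintegrable f -> Cintegrable g ->
  Cintegral mu (fun x => f x + g x) = Cintegral mu f + Cintegral mu g.
Proof.
move=> [fr fi] [gr gi]; rewrite /Cintegral; apply/eqP; rewrite eq_complex /=.
rewrite -!RintegralD//; apply/andP; split; apply/eqP; apply: eq_Rintegral => x _;
  by case: (f x) (g x) => [a b] [c e].
Qed.

Lemma CintegralZ a f : Cintegrable f ->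
  Cintegral mu (fun x => a * f x) = a * Cintegral mu f.
Proof.
move=> [fr fi]; have [iZr iZi] : (forall r : R, mu.-integrable setT (EFin \o
    (fun x => r * complex.Re (f x)))) /\ (forall r : R, mu.-integrable setT (EFin \o
    (fun x => r * complex.Im (f x)))).
  by split=> r; [have := integrableZl measurableT r fr|
    have := integrableZl measurableT r fi]; apply: eq_integrable.
case: a => a b; rewrite /Cintegral; apply/eqP; rewrite eq_complex /=.
rewrite -!RintegralZl// -RintegralB// -RintegralD//.
by apply/andP; split; apply/eqP; apply: eq_Rintegral => x _; case: (f x).
Qed.

Lemma Cintegral_conj f : Cintegrable f ->
  Cintegral mu (fun x => (f x)^*) = (Cintegral mu f)^*.
Proof.
move=> [fr fi]; rewrite /Cintegral; apply/eqP; rewrite eq_complex /=.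
rewrite -[- (\int[mu]_x _)]mulN1r -RintegralZl//.
apply/andP; split; apply/eqP; apply: eq_Rintegral => x _; case: (f x) => //= a b.
by rewrite mulN1r.
Qed.

Lemma ae_eq_Cintegral f g : Cintegrable f -> Cintegrable g ->
  (\forall x \ae mu, f x = g x) -> Cintegral mu f = Cintegral mu g.
Proof.
move=> [/integrableP[fr _] /integrableP[fi _]] [/integrableP[gr _] /integrableP[gi _]] fg.
rewrite /Cintegral /Rintegral; congr (fine _ +i* fine _).
  by apply: ae_eq_integral => //; apply: filterS fg => x /= -> .
by apply: ae_eq_integral => //; apply: filterS fg => x /= -> .
Qed.

Lemma sqint_mul (f g : L2fun) : Cintegrable (fun x => val f x * (val g x)^*).
Proof.
have /sqintE/square_integrableP[fr fi] := valP f.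
have /sqintE/square_integrableP[gr gi] := valP g.
have M := fun a b ha hb => (Lfun1_integrable _ _).1 (@Lfun2_mul_Lfun1 _ _ _ mu a b ha hb).
split.
  have := integrableD measurableT (M _ _ fr gr) (M _ _ fi gi).
  apply: eq_integrable => // x _ /=; case: (sval f x) (sval g x) => [a b] [c e] /=.
  by rewrite -EFinD mulrN opprK.
have := integrableB measurableT (M _ _ fi gr) (M _ _ fr gi).
apply: eq_integrable => // x _ /=; case: (sval f x) (sval g x) => [a b] [c e] /=.
by rewrite -EFinB mulrN addrC.
Qed.

(* Linear in the first argument, conjugate-linear in the second. *)
Definition L2dot (u v : L2) : R[i] :=
  Cintegral mu (fun x => val (L2repr u) x * (val (L2repr v) x)^*).

Lemma L2dotE (f g : L2fun) : L2dot (L2class f) (L2class g) =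
  Cintegral mu (fun x => val f x * (val g x)^*).
Proof.
apply: ae_eq_Cintegral; try exact: sqint_mul.
by apply: filterS2 (L2repr_class f) (L2repr_class g) => x -> ->.
Qed.

Lemma L2dot_linearl v : scalar (L2dot^~ v).
Proof.
move=> a u w; rewrite -[u]L2reprK -[w]L2reprK -[v]L2reprK.
rewrite -[a *: _]L2classZ -L2classD !L2dotE.
rewrite -CintegralZ -?CintegralD; try exact: sqint_mul.
  rewrite /Cintegral; congr (_ +i* _); apply: eq_Rintegral => x _;
  by have -> : val (a *: L2repr u + L2repr w) x =
    a * val (L2repr u) x + val (L2repr w) x by []; rewrite mulrDl mulrA.
have := sqint_mul (a *: L2repr u) (L2repr v).
by congr Cintegrable; apply/funext => x; rewrite -mulrA.
Qed.

Lemma L2dot_herm u v : L2dot u v = (-1) ^+ false * (L2dot v u)^*.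
Proof.
rewrite expr0 mul1r -Cintegral_conj; last exact: sqint_mul.
rewrite /Cintegral; congr (_ +i* _); apply: eq_Rintegral => x _;
  by rewrite rmorphM /= conjCK mulrC.
Qed.

Lemma L2dot_linearr u : linear_for (Num.conj \; *%R) (L2dot u).
Proof.
move=> a v w; rewrite L2dot_herm L2dot_linearl expr0 mul1r rmorphD rmorphM /=.
by rewrite [in RHS]L2dot_herm [L2dot u w]L2dot_herm !expr0 !mul1r.
Qed.

Lemma L2dot_gt0 u : u != 0 -> 0 < L2dot u u.
Proof.
move=> u0; set f := L2repr u.
have mm : measurable_fun setT (fun x => ((normc (val f x)) ^+ 2)%:E).
  have /sqintE[mr mi _] := valP f.
  under eq_fun do rewrite normc_sqr.
  by apply/measurable_EFinP/measurable_funD; apply: measurable_funX.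
have ff : (\int[mu]_x ((normc (val f x)) ^+ 2)%:E < +oo)%E.
  by have /sqintE[] := valP f.
have E : L2dot u u = (fine (\int[mu]_x ((normc (val f x)) ^+ 2)%:E)%E)%:C.
  rewrite /L2dot -/f /Cintegral /Rintegral; congr (fine _ +i* _).
    apply: eq_integral => x _; rewrite normc_sqr.
    by case: (val f x) => a b /=; rewrite mulrN opprK.
  rewrite (_ : (fun x => _) = cst 0) ?integral_cst ?mul0e//.
  by apply/funext => x; case: (val f x) => a b /=; rewrite mulrN mulrC addrC subrr.
have I0 : (0 <= \int[mu]_x ((normc (val f x)) ^+ 2)%:E)%E.
  by apply: integral_ge0 => x _; rewrite lee_fin sqr_ge0.
rewrite E ltcR lt0r fine_ge0// andbT; apply: contra u0 => /eqP I.
have {}I : (\int[mu]_x `|((normc (val f x)) ^+ 2)%:E| = 0)%E.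
  rewrite -[RHS]/(0%:E) -I fineK ?ge0_fin_numE//; apply: eq_integral => x _.
  by rewrite gee0_abs// lee_fin sqr_ge0.
have := (ae_eq_integral_abs mu measurableT mm).1 I => nf.
rewrite -L2class0 -[u]L2reprK; apply/eqP/L2class_eqP.
apply: filterS nf => x /(_ Logic.I) [] /eqP; rewrite sqrf_eq0 => /eqP.
by move=> /eq0_normc.
Qed.

HB.instance Definition _ := bilinear_isBilinear.Build R[i] L2 L2 R[i]
  *%R (Num.conj \; *%R) L2dot (L2dot_linearl, L2dot_linearr).
HB.instance Definition _ := isHermitianSesquilinear.Build R[i] L2 false
  Num.conj L2dot L2dot_herm.
HB.instance Definition _ := isDotProduct.Build R[i] L2 L2dot L2dot_gt0.

End L2space.

Section L2norm.
Context d (T : measurableType d) (R : realType).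
Variable mu : {measure set T -> \bar R}.

HB.instance Definition _ := Lmodule_isNormed.Build R[i] (L2 mu)
  (dot_normD (@L2dot d T R mu)) (dot_normZ (@L2dot d T R mu))
  (dot_norm0_eq0 (dot := @L2dot d T R mu)).

Lemma L2norm_sqr (u : L2 mu) : `|u| ^+ 2 = L2dot u u.
Proof. exact: (dot_norm_sqr (@L2dot d T R mu)). Qed.

End L2norm.

Definition unit_circle (R : realType) : Type :=
  set_type [set z : R[i]^o | `|z| = 1].

HB.instance Definition _ (R : realType) := Topological.on (unit_circle R).
HB.instance Definition _ (R : realType) := isPointed.Build (unit_circle R)
  (SigSub (mem_set (normr1 _ : [set z : R[i]^o | `|z| = 1] 1))).

(* The unit circle with the Borel sigma-algebra of its subspace topology. *)
Definition circle (R : realType) : Type :=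
  g_sigma_algebraType (@open (unit_circle R)).

HB.instance Definition _ (R : realType) := Measurable.on (circle R).

Section Circle.
Context (R : realType).

(* The independent variable, i.e. the inclusion of the circle in C. *)
Definition xi (x : circle R) : R[i]^o := set_val (x : unit_circle R).

Lemma norm_xi x : `|xi x| = 1.
Proof. by rewrite /xi; case: x => z /= zC; have := set_mem zC. Qed.

Lemma continuous_measurable_circle (f : unit_circle R -> R) :
  continuous f -> measurable_fun setT (f : circle R -> R).
Proof.
move=> cf; apply: (measurability _ (RGenOInfty.measurableE R)).
move=> _ [_ [r ->] <-]; rewrite setTI; apply: sub_sigma_algebra.
by apply: open_comp => //; exact: open_gt.
Qed.

Lemma Re_continuous : continuous (@complex.Re R : R[i]^o -> R).
Proof.
move=> z; apply/(@cvgrPdist_lt R R^o _ (nbhs (z : R[i]^o)) (nbhs_filter _)) => e e0.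
apply/nbhs_ballP; exists e%:C => /=; first by rewrite ltcR.
move=> w zw; rewrite -ltcR; apply: le_lt_trans zw.
by rewrite -raddfB /=; exact: normc_ge_Re.
Qed.

Lemma Im_continuous : continuous (@complex.Im R : R[i]^o -> R).
Proof.
move=> z; apply/(@cvgrPdist_lt R R^o _ (nbhs (z : R[i]^o)) (nbhs_filter _)) => e e0.
apply/nbhs_ballP; exists e%:C => /=; first by rewrite ltcR.
move=> w zw; rewrite -ltcR; apply: le_lt_trans zw.
rewrite -raddfB /= -normrN -ReiNIm (le_trans (normc_ge_Re _))//.
by rewrite normrM [`|'i%C|](_ : _ = 1) ?mulr1// normc_def /= expr0n expr1n add0r sqrtr1.
Qed.

Lemma measurable_xi : measurable_fun setT (fun x => complex.Re (xi x)) /\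
  measurable_fun setT (fun x => complex.Im (xi x)).
Proof.
split; apply: (@continuous_measurable_circle (_ \o set_val)) => x.
  by apply: continuous_comp; [exact: initial_continuous|exact: Re_continuous].
by apply: continuous_comp; [exact: initial_continuous|exact: Im_continuous].
Qed.


End Circle.

Section CircleL2.
Context (R : realType) (mu : probability (circle R) R).

Let ReJ (z : R[i]) : complex.Re z^* = complex.Re z. Proof. by case: z. Qed.
Let ImJ (z : R[i]) : complex.Im z^* = - complex.Im z. Proof. by case: z. Qed.
Let ReM (z w : R[i]) : complex.Re (z * w) =
  complex.Re z * complex.Re w - complex.Im z * complex.Im w.
Proof. by case: z w => [a b] [c e]. Qed.
Let ImM (z w : R[i]) : complex.Im (z * w) =
  complex.Re z * complex.Im w + complex.Im z * complex.Re w.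
Proof. by case: z w => [a b] [c e]. Qed.

Lemma normc_xi (x : circle R) : normc (xi x) = 1.
Proof. by have := norm_xi x => -[]. Qed.

Lemma one_sqint : (fun=> 1) \in sqint mu.
Proof.
by apply/sqintE/square_integrableP; split; apply: (Lfun_cst mu _ 2).
Qed.

Lemma xibar_sqint : (fun x : circle R => (xi x)^*) \in sqint mu.
Proof.
have [mr mi] := measurable_xi R; apply/sqintE; split.
- by under eq_fun do rewrite ReJ.
- by under eq_fun do rewrite ImJ; exact: measurable_funN.
- under eq_integral => x _.
    rewrite (_ : normc (xi x)^* = 1) ?expr1n; last first.
      by have := norm_conjC (xi x); rewrite norm_xi => -[].
    over.
  by rewrite integral_cst// mul1e (le_lt_trans (probability_le1 mu measurableT))// ltry.
Qed.

Lemma xi_mul_sqint (f : L2fun mu) : (fun x : circle R => xi x * val f x) \in sqint mu.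
Proof.
have [mr mi] := measurable_xi R; have /sqintE[fr fi ff] := valP f.
apply/sqintE; split.
- under eq_fun do rewrite ReM.
  by apply: measurable_funB; apply: measurable_funM.
- under eq_fun do rewrite ImM.
  by apply: measurable_funD; apply: measurable_funM.
- by under eq_integral do rewrite normcM normc_xi mul1r.
Qed.

Definition L2one : L2 mu := L2mk one_sqint.

Definition L2xibar : L2 mu := L2mk xibar_sqint.

Definition Mxi (u : L2 mu) : L2 mu :=
  L2mk (xi_mul_sqint (L2repr u)).

Lemma Mxi_class (f : L2fun mu) :
  Mxi (L2class f) = L2mk (xi_mul_sqint f).
Proof. by apply/L2class_eqP; apply: filterS (L2repr_class f) => x /= ->. Qed.

Lemma Mxi_linear : linear Mxi.
Proof.
move=> a u v; rewrite -[u]L2reprK -[v]L2reprK.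
rewrite -[a *: _]L2classZ -L2classD !Mxi_class -[a *: _]L2classZ -L2classD.
congr L2class; apply/val_inj/funext => x.
by rewrite /= !fctE /= mulrDr /GRing.scale /= mulrCA.
Qed.

HB.instance Definition _ := GRing.isLinear.Build R[i] (L2 mu) (L2 mu) *:%R
  Mxi Mxi_linear.

Definition Uhat (beta : R[i]) (u : L2 mu) : L2 mu :=
  Mxi u + ((beta - 1) * L2dot u L2xibar) *: L2one.

(* The scalar c determined by Theta_beta(z) xibar = c 1; in [v] we record that
   xibar belongs to clos ran D_X, on which Theta_beta(z) is defined. *)
Definition scalar_char_fun (beta z : R[i]) : R[i] :=
  get [set c : R[i]^o |
    exists v : closure (range (defect (@L2dot _ _ _ mu) (Uhat beta))),
      set_val v = L2xibar /\
      char_op_fun (@L2dot _ _ _ mu) (Uhat beta) z v = c *: L2one].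

Definition cauchy_transform (f : circle R -> R[i]) (z : R[i]) : R[i] :=
  Cintegral mu (fun x => f x / (1 - (xi x)^* * z)).

End CircleL2.

(* Main.v *)
(* With [V = M_xi], [b = \bar xi] and [e = V b = 1], the operator [X] is [V] changed
   only on the line of [b], where [X b = beta e].  Hence [I - X^* X] and [I - X X^*]
   are [1 - |beta|^2] times the orthogonal projections on [b] and [e], and [I - z X^*]
   is a rank-one perturbation of [I - z V^*], the multiplication by [1 - z \bar xi],
   so it is inverted by the Sherman-Morrison formula.  Its denominator
   [1 - z (\bar beta - 1) K(\bar xi mu)(z)] equals
   [K mu (z) - z \bar beta K(\bar xi mu)(z)] because [K mu = 1 + z K(\bar xi mu)]. *)
From HB Require Import structures.
Require Import Defs.
From mathcomp Require Import all_boot all_order all_algebra.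
From mathcomp Require Import complex ring.
From mathcomp Require Import all_classical all_reals all_analysis.
From mathcomp Require Import measurable_realfun.
Import Order.TTheory GRing.Theory Num.Theory.
Import numFieldNormedType.Exports.
Local Open Scope ring_scope.

(** [adjoint], [psqrt] and [op_inverse] choose among bundled linear maps, so an explicit formula
    must be bundled before it can serve as a witness. *)
Lemma linear_exists (C : nzRingType) (H : lmodType C) (f : H -> H) :
  linear f -> exists g : {linear H -> H}, g =1 f.
Proof.
move=> lf.
pose m := GRing.isLinear.Build C H H *:%R f lf.
pose F : {linear H -> H} := HB.pack f m.
by exists F.
Qed.

(** * Identifying adjoints, inverses and positive square roots with explicit formulas *)

Section Hilbert.
Context {C : numClosedFieldType} {H : normedModType C}.
Variable dot : {dot H for Num.conj}.
Hypothesis norm_dot : forall u : H, `|u| ^+ 2 = dot u u.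
Implicit Types u v w : H.

Lemma linear_bound_continuous (f : {linear H -> H}) (M : C) :
  (forall u, `|f u| <= M * `|u|) -> continuous f.
Proof.
move=> fM; apply/linear_bounded_continuous/bounded_funP => r.
exists (`|M| * `|r|) => u ur; apply: le_trans (fM u) _.
have M0 : M * `|u| \is Num.real by apply: ger0_real; apply: (le_trans _ (fM u)).
apply: le_trans (real_ler_norm M0) _.
rewrite normrM normr_id ler_wpM2l//.
apply: (le_trans ur (real_ler_norm _)).
by apply: ger0_real; apply: (le_trans _ ur).
Qed.

Lemma dotC u v : (dot u v)^* = dot v u.
Proof. by rewrite [dot v u]hermC expr0 mul1r. Qed.

Lemma normr_dot_le u v : `|dot u v| <= `|u| * `|v|.
Proof.
rewrite -(@ler_pXn2r _ 2)// ?nnegrE ?mulr_ge0//.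
by rewrite exprMn !norm_dot dot_CauchySchwarz.
Qed.

Lemma dot_inj u v : (forall w, dot w u = dot w v) -> u = v.
Proof.
move=> uv; apply/eqP; rewrite -subr_eq0 -(dnorm_eq0 dot).
by rewrite (linearBr dot) /= uv subrr.
Qed.

(** The inner product is nondegenerate, so two adjoints of [X] coincide; the bound makes [Y]
    continuous, hence an admissible choice for [get]. *)
Lemma adjointP (X : H -> H) (Y : H -> H) (M : C) : linear Y ->
  (forall u, `|Y u| <= M * `|u|) ->
  (forall u v, dot (X u) v = dot u (Y v)) ->
  adjoint dot X =1 Y.
Proof.
move=> /linear_exists[Z ZY] YM XY u; apply: dot_inj => w; rewrite -XY.
have [|_ /(_ w u) <-//] := getPex (P := [set Y : {linear H -> H} |
    continuous Y /\ forall u v, dot (X u) v = dot u (Y v)]%classic).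
exists Z; split; last by move=> *; rewrite ZY.
by apply: (linear_bound_continuous _ M) => v; rewrite ZY.
Qed.

(** If [I] is the chosen inverse, then [I u = I (A (B u)) = B u]. *)
Lemma op_inverseP (A B : H -> H) (M : C) : linear B ->
  (forall u, `|B u| <= M * `|u|) -> cancel A B -> cancel B A ->
  op_inverse A =1 B.
Proof.
move=> /linear_exists[Z ZB] BM AB BA u.
have [|_ AI IA] := getPex (P := [set B : {linear H -> H} |
    [/\ continuous B, cancel A B & cancel B A]]%classic).
  exists Z; split; first by apply: (linear_bound_continuous _ M) => v; rewrite ZB.
    by move=> v; rewrite ZB.
  by move=> v; rewrite ZB.
by rewrite -[RHS]AI BA.
Qed.

Lemma rank1_linear (c : C) (a b : H) : linear (fun u : H => (c * dot u a) *: b).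
Proof.
move=> k u v; rewrite (linearDl dot) (linearZl_LR dot) /= mulrDr scalerDl mulrCA.
by rewrite scalerA.
Qed.

Lemma rank1_bound (c : C) (a b u : H) :
  `|(c * dot u a) *: b| <= `|c| * `|a| * `|b| * `|u|.
Proof.
rewrite normrZ normrM [leRHS]mulrAC ler_wpM2r// -!mulrA ler_wpM2l//.
by rewrite mulrC normr_dot_le.
Qed.

(* Polarization: the form [dot (S (u + k *: v)) (u + k *: v)] is real for [k = 1]
   and [k = 'i]. *)
Lemma pos_selfadjoint (S : {linear H -> H}) : (forall v, 0 <= dot (S v) v) ->
  forall u v, dot (S u) v = dot u (S v).
Proof.
move=> S0 u v.
have real_form k : k^* * dot (S u) v + k * dot (S v) u \is Num.real.
  have -> : k^* * dot (S u) v + k * dot (S v) u =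
      dot (S (u + k *: v)) (u + k *: v) - dot (S u) u - `|k| ^+ 2 * dot (S v) v.
    rewrite (linearD S) (linearZ_LR S) /= (linearDl dot) !(linearDr dot).
    rewrite !(linearZl_LR dot) !(linearZr_LR dot) /=.
    by rewrite normCK; ring.
  by rewrite !realB ?realM ?ger0_real ?exprn_ge0.
have := conj_Creal (real_form 1); have := conj_Creal (real_form 'i).
rewrite !rmorphD !rmorphM /= !conjCK !conjC1 !mul1r conjCi !dotC.
set x := dot (S u) v; set y := dot (S v) u.
set x' := dot v (S u); set y' := dot u (S v) => hi h1.
have {}hi : x' - y' = y - x.
  apply: (mulfI (neq0Ci C)); rewrite -[LHS]opprK -mulrN opprB mulrBr.
  by rewrite opprB mulrBr addrC [in RHS]addrC -mulNr -hi; ring.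
have : y' *+ 2 = x *+ 2.
  rewrite (_ : y' *+ 2 = x' + y' - (x' - y')); last by ring.
  by rewrite h1 hi; ring.
by move/eqP; rewrite eqrMn2r// => /orP[//|/eqP].
Qed.

(** A positive square root [S] is self-adjoint, so [dot (S v) (S v) = dot (S (S v)) v] and [S]
    vanishes on the orthogonal complement of [b]. It then maps [b] to a multiple [c *: b] with
    [c >= 0] and [c ^+ 2 = s ^+ 2], which forces [c = s]. *)
Lemma psqrt_rank1 (b : H) (s : C) : dot b b = 1 -> 0 <= s ->
  psqrt dot (fun v => (s ^+ 2 * dot v b) *: b) =1 (fun v => (s * dot v b) *: b).
Proof.
move=> b1 s0 u.
have [|_ S0 SS] := getPex (P := [set S : {linear H -> H} |
    [/\ continuous S, forall v, 0 <= dot (S v) v &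
        S \o S = fun v => (s ^+ 2 * dot v b) *: b]]%classic).
  have [S SE] := linear_exists _ _ _ (rank1_linear s b b); exists S; split.
  - apply: (linear_bound_continuous _ (`|s| * `|b| * `|b|)) => v.
    by rewrite SE rank1_bound.
  - move=> v; rewrite SE (linearZl_LR dot) /= -[dot b v]dotC -mulrA -normCK.
    by rewrite mulr_ge0 ?exprn_ge0.
  - apply/funext => v /=; rewrite !SE (linearZl_LR dot) /= b1 mulr1.
    by rewrite expr2 mulrA.
rewrite -/(psqrt dot _) in S0 SS *; set S := psqrt _ _ in S0 SS *.
have {}SS v : S (S v) = (s ^+ 2 * dot v b) *: b by rewrite -[LHS]/((S \o S) v) SS.
have SA := pos_selfadjoint _ S0.
have S_perp v : dot v b = 0 -> S v = 0.
  move=> vb; apply/eqP; rewrite -(dnorm_eq0 dot) SA SS vb mulr0 scale0r.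
  by rewrite (linear0r dot).
set c := dot (S b) b.
have Sb : S b = c *: b.
  apply/eqP; rewrite -subr_eq0 -(dnorm_eq0 dot).
  (* Put [y = S b - c *: b]. As [y] is orthogonal to [b], [dot y y = dot y (S b) = dot (S y) b], and
     [S y = 0]. *)
  have yb : dot (S b - c *: b) b = 0.
    by rewrite (linearBl dot) (linearZl_LR dot) /= b1 mulr1 subrr.
  rewrite [X in dot _ X](_ : _ = S b - c *: b)//.
  rewrite (linearBr dot) (linearZr_LR dot) /= yb mulr0 subr0 -SA S_perp//.
  by rewrite (linear0l dot).
have cs : c = s.
  have c0 : 0 <= c by exact: S0.
  apply/eqP; rewrite -(@eqrXn2 _ 2)//; apply/eqP.
  have := congr1 (fun x => dot x b) (SS b).
  by rewrite Sb linearZ /= Sb scalerA !(linearZl_LR dot) /= b1 !mulr1 expr2.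
(* Split [u] into its projection on [b] and the orthogonal remainder, which [S] kills. *)
rewrite -{1}[u](subrK (dot u b *: b)) (linearD S) (linearZ_LR S) /= Sb cs S_perp.
  by rewrite add0r scalerA mulrC.
by rewrite (linearBl dot) (linearZl_LR dot) /= b1 mulr1 subrr.
Qed.

End Hilbert.

(** * Rank-one perturbation of a unitary operator [V] with inverse [W] *)

Section RankOnePerturbation.
Context {C : numClosedFieldType} {H : normedModType C}.
Variable dot : {dot H for Num.conj}.
Hypothesis norm_dot : forall u : H, `|u| ^+ 2 = dot u u.
Variables (V W : {linear H -> H}) (b : H) (beta : C).
Hypothesis VK : cancel V W.
Hypothesis WK : cancel W V.
Hypothesis VW : forall u v, dot (V u) v = dot u (W v).
Hypothesis b1 : dot b b = 1.
Hypothesis beta1 : `|beta| < 1.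
Implicit Types u v w : H.

Let e := V b.
Let X u := V u + ((beta - 1) * dot u b) *: e.
(** Candidate for the adjoint of [X]: the map [u -> dot u b *: e] has adjoint
    [v -> dot v e *: b]. *)
Let Y u := W u + ((beta^* - 1) * dot u e) *: b.

Let We : W e = b. Proof. exact: VK. Qed.

Let dotWW u v : dot (W u) (W v) = dot u v.
Proof. by rewrite -VW WK. Qed.

Let e1 : dot e e = 1. Proof. by rewrite VW We. Qed.

Let normW u : `|W u| = `|u|.
Proof.
by apply/eqP; rewrite -(@eqrXn2 _ 2)// !norm_dot dotWW.
Qed.

Let Y_linear : linear Y.
Proof.
by move=> k u v; rewrite /Y linearP (rank1_linear dot) scalerDr addrACA.
Qed.

Let XY u v : dot (X u) v = dot u (Y v).
Proof.
rewrite /X /Y (linearDl dot) (linearDr dot) /= VW.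
rewrite (linearZl_LR dot) (linearZr_LR dot) /=.
rewrite rmorphM rmorphB /= conjCK conjC1 dotC; ring.
Qed.

Lemma adjoint_perturbation : adjoint dot X =1 Y.
Proof.
refine (adjointP dot X Y (1 + `|beta^* - 1| * `|e| * `|b|) Y_linear _ XY) => u.
rewrite /Y [leRHS]mulrDl mul1r (le_trans (ler_normD _ _))// normW lerD2l.
exact: (rank1_bound dot norm_dot).
Qed.

(** The only nonzero eigenvalue of each of the two defect operators. *)
Let s := sqrtC (1 - `|beta| ^+ 2).

Let sub_gt0 : 0 < 1 - `|beta| ^+ 2.
Proof. by rewrite subr_gt0 expr_lt1. Qed.

Let s_ge0 : 0 <= s. Proof. by rewrite sqrtC_ge0 ltW. Qed.
Let s2 : s ^+ 2 = 1 - `|beta| ^+ 2. Proof. exact: sqrtCK. Qed.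

(** Since [dot (X u) e = beta * dot u b], the coefficient of [dot u b *: b] is
    $(\beta-1)+(\bar\beta-1)\beta=|\beta|^2-1$. *)
Let YX u : Y (X u) = u - (s ^+ 2 * dot u b) *: b.
Proof.
rewrite s2 normCK /Y /X (linearD W) (linearZ_LR W) /= VK We.
rewrite (linearDl dot) /= VW We (linearZl_LR dot) /= e1.
rewrite -addrA -scalerDl -scaleNr; congr (_ + _ *: _); ring.
Qed.

Let XYE u : X (Y u) = u - (s ^+ 2 * dot u e) *: e.
Proof.
rewrite s2 normCK /X /Y (linearD V) (linearZ_LR V) /= WK (linearDl dot) /=.
rewrite -/e -[dot (W u) b]dotC -VW -/e dotC (linearZl_LR dot) /= b1.
rewrite -addrA -scalerDl -scaleNr; congr (_ + _ *: _); ring.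
Qed.

Lemma defect_perturbation : defect dot X =1 (fun v => (s * dot v b) *: b).
Proof.
move=> u; rewrite -(psqrt_rank1 _ norm_dot)// /defect.
congr (psqrt dot _ u); apply/funext => v.
by rewrite adjoint_perturbation YX opprB addrC subrK.
Qed.

Lemma defect_adj_perturbation :
  defect_adj dot X =1 (fun v => (s * dot v e) *: e).
Proof.
move=> u; rewrite -(psqrt_rank1 _ norm_dot)// /defect_adj.
congr (psqrt dot _ u); apply/funext => v.
by rewrite adjoint_perturbation XYE opprB addrC subrK.
Qed.

(** $\|Yu\|^2=(XYu,u)=\|u\|^2-s^2|(u,e)|^2$. *)
Let Y_contraction u : `|Y u| <= `|u|.
Proof.
rewrite -(@ler_pXn2r _ 2)// ?nnegrE// !norm_dot -XY XYE.
rewrite (linearBl dot) (linearZl_LR dot) /=.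
by rewrite gerBl -[dot e u]dotC -mulrA -normCK mulr_ge0 ?exprn_ge0.
Qed.

Lemma closure_range_defect : closure (range (defect dot X)) b.
Proof.
(* [b] is an eigenvector of the defect operator for the eigenvalue [s], which is nonzero because
   $|\beta|<1$. *)
apply: subset_closure; exists (s^-1 *: b) => //.
rewrite defect_perturbation (linearZl_LR dot) /= b1 mulr1.
by rewrite divff ?scale1r// gt_eqF ?sqrtC_gt0.
Qed.

(** * Inverse of $I-zX^*$ and the characteristic function, given the inverse [Rz] of $I-zW$ *)

Section Resolvent.
Variables (z : C) (Rz : {linear H -> H}) (M : C).
Hypothesis z1 : `|z| < 1.
Hypothesis RzK : forall u, Rz u - z *: W (Rz u) = u.
Hypothesis KRz : forall u, Rz (u - z *: W u) = u.
Hypothesis RzM : forall u, `|Rz u| <= M * `|u|.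

(** On the circle this number becomes $K(\bar\xi\mu)(z)$. *)
Let k := dot (Rz b) e.
Let den := 1 - z * (beta^* - 1) * k.

(* If [den = 0] then [Rz b != 0] is a fixed point of [z *: Y], which is
   impossible because [Y] is a contraction and [|z| < 1]. *)
Let den_neq0 : den != 0.
Proof.
apply/eqP => den0.
have zk : z * (beta^* - 1) * k = 1 by apply/esym/eqP; rewrite -subr_eq0 -/den den0.
have fixR : Rz b = z *: Y (Rz b).
  by apply/eqP; rewrite -subr_eq0 /Y -/k scalerDr opprD addrA RzK scalerA mulrA zk
    scale1r subrr.
have R0 : Rz b = 0.
  apply/eqP; rewrite -normr_eq0 eq_le normr_ge0 andbT.
  have : (1 - `|z|) * `|Rz b| <= 0.
    rewrite mulrBl mul1r subr_le0 {1}fixR normrZ ler_wpM2l//.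
  by rewrite pmulr_rle0 ?subr_gt0.
by move: zk; rewrite /k R0 (linear0l dot) mulr0 => /esym/eqP; rewrite oner_eq0.
Qed.

(* Sherman-Morrison *)
Lemma op_inverse_perturbation :
  op_inverse (fun w => w - z *: adjoint dot X w) b = den^-1 *: Rz b.
Proof.
pose B u := Rz u + (z * (beta^* - 1) / den * dot (Rz u) e) *: Rz b.
have -> : (fun w => w - z *: adjoint dot X w) = (fun w => w - z *: Y w).
  by apply/funext => w; rewrite adjoint_perturbation.
have E w : w - z *: Y w = (w - z *: W w) - (z * (beta^* - 1) * dot w e) *: b.
  by rewrite /Y scalerDr opprD addrA scalerA mulrA.
rewrite (op_inverseP _ B (M + `|z * (beta^* - 1) / den| * `|e| * `|Rz b| * M)).
(* At [b] the two terms of [B] merge: $1+z(\bar\beta-1)k/den=1/den$, because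
   $den+z(\bar\beta-1)k=1$. *)
- rewrite /B -/k -[X in X + _]scale1r -scalerDl; congr (_ *: _).
  by rewrite /den; field.
- move=> c u v; rewrite /B linearP (linearDl dot) (linearZl_LR dot) /= mulrDr scalerDl.
  by rewrite scalerDr addrACA scalerA mulrCA.
- move=> u; rewrite /B [leRHS]mulrDl (le_trans (ler_normD _ _))// lerD//.
  apply: le_trans (rank1_bound _ norm_dot _ _ _ _) _.
  by rewrite -[leRHS]mulrA ler_wpM2l ?mulr_ge0.
- move=> w; rewrite E /B (linearB Rz) (linearZ_LR Rz) /= KRz.
  rewrite (linearBl dot) (linearZl_LR dot) /= -/k.
  rewrite -addrA -scaleNr -scalerDl [X in X *: Rz b](_ : _ = 0) ?scale0r ?addr0//.
  by rewrite /den; field.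
- move=> u; rewrite E /B (linearD W) (linearZ_LR W) /= scalerDr opprD addrACA RzK.
  set d := _ / den * _.
  have -> : z *: (d *: W (Rz b)) = d *: (z *: W (Rz b)).
    by rewrite !scalerA [z * d]mulrC.
  rewrite -scalerBr RzK {}/d.
  rewrite (linearDl dot) (linearZl_LR dot) /= -/k.
  rewrite -addrA -scaleNr -scalerDl [X in X *: b](_ : _ = 0) ?scale0r ?addr0//.
  by rewrite /den; field.
Qed.

(** Here [- X b = - beta *: e]. In the second term the defect operator sends [b] to [s *: b], the
    inverse turns this into [(s / den) *: Rz b], and the other defect operator takes [s] times the
    inner product with [e], leaving [s ^+ 2 * (k / den)]. *)
Lemma char_op_fun_perturbation (v : closure (range (defect dot X))) :
  set_val v = b ->
  char_op_fun dot X z v = (- beta + z * (1 - `|beta| ^+ 2) * (k / den)) *: e.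
Proof.
move=> vb; rewrite /char_op_fun /sigL /= vb defect_perturbation b1 mulr1.
rewrite linearZ /= op_inverse_perturbation defect_adj_perturbation.
rewrite !(linearZl_LR dot) /= -/k /X b1 mulr1 -[V b]/e -s2.
rewrite -{1}[e]scale1r -scalerDl -scaleNr scalerA -scalerDl; congr (_ *: _).
by field.
Qed.

End Resolvent.
End RankOnePerturbation.

(** * Multiplication by a bounded measurable function on $L^2(\mu)$ *)

Section Multiplication.
Context d (T : measurableType d) (R : realType) (mu : {measure set T -> \bar R}).
Variables (g : T -> R[i]) (M : R).
Hypothesis mReg : measurable_fun setT (fun x => complex.Re (g x)).
Hypothesis mImg : measurable_fun setT (fun x => complex.Im (g x)).
Hypothesis gM : forall x, ComplexField.Normc.normc (g x) <= M.

Let measurable_sqr (f : L2fun mu) :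
  measurable_fun setT (fun x => ((ComplexField.Normc.normc (val f x)) ^+ 2)%:E).
Proof.
have /sqintE[mr mi _] := valP f.
under eq_fun do rewrite normc_sqr.
by apply/measurable_EFinP/measurable_funD; apply: measurable_funX.
Qed.

Let le_sqr (w : R[i]) x :
  ComplexField.Normc.normc (g x * w) ^+ 2 <= M ^+ 2 * ComplexField.Normc.normc w ^+ 2.
Proof.
rewrite ComplexField.Normc.normcM exprMn ler_wpM2r ?sqr_ge0//.
rewrite ler_sqr ?nnegrE ?(le_trans _ (gM x))//.
  by case: (g x) => a b; rewrite sqrtr_ge0.
by case: (g x) => a b; rewrite sqrtr_ge0.
Qed.

Lemma mul_sqint (f : L2fun mu) : (fun x => g x * val f x) \in sqint mu.
Proof.
have /sqintE[fr fi ff] := valP f.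
have mr : measurable_fun setT (fun x => complex.Re (g x * val f x)).
  rewrite (_ : (fun _ => _) = fun x => complex.Re (g x) * complex.Re (val f x) -
    complex.Im (g x) * complex.Im (val f x)).
    by apply: measurable_funB; apply: measurable_funM.
  by apply/funext => x; case: (g x) (val f x) => [a b] [c e].
have mi : measurable_fun setT (fun x => complex.Im (g x * val f x)).
  rewrite (_ : (fun _ => _) = fun x => complex.Re (g x) * complex.Im (val f x) +
    complex.Im (g x) * complex.Re (val f x)).
    by apply: measurable_funD; apply: measurable_funM.
  by apply/funext => x; case: (g x) (val f x) => [a b] [c e].
apply/sqintE; split => //.
(* Dominate $|gf|^2$ by $M^2|f|^2$. *)
apply: (@le_lt_trans _ _ (\int[mu]_x ((M ^+ 2)%:E *
    (ComplexField.Normc.normc (val f x) ^+ 2)%:E))%E); last first.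
  rewrite ge0_integralZl//.
  - by rewrite lte_mul_pinfty ?lee_fin ?sqr_ge0.
  - by move=> x _; rewrite lee_fin sqr_ge0.
  - by rewrite lee_fin sqr_ge0.
apply: ge0_le_integral => //.
- by move=> x _; rewrite lee_fin sqr_ge0.
- under eq_fun do rewrite normc_sqr.
  by apply/measurable_EFinP/measurable_funD; apply: measurable_funX.
- exact: measurable_funeM.
- by move=> x _; rewrite -EFinM lee_fin le_sqr.
Qed.

Let L2dot_self (f : L2fun mu) : L2dot (L2class f) (L2class f) =
  (\int[mu]_x (ComplexField.Normc.normc (val f x) ^+ 2))%:C%C.
Proof.
rewrite L2dotE /Cintegral; apply/eqP; rewrite eq_complex; apply/andP; split; apply/eqP.
  apply: eq_Rintegral => x _; rewrite normc_sqr.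
  by case: (val f x) => a b /=; rewrite mulrN opprK.
rewrite [RHS](_ : _ = \int[mu]_x (0 : R)); last by rewrite /Rintegral integral0.
apply: eq_Rintegral => x _.
by case: (val f x) => a b /=; rewrite mulrN mulrC addrC subrr.
Qed.

Let integrable_sqr (f : L2fun mu) :
  mu.-integrable setT (EFin \o (fun x => ComplexField.Normc.normc (val f x) ^+ 2)).
Proof.
have /sqintE[_ _ ff] := valP f; apply/integrableP; split; first exact: measurable_sqr.
apply: le_lt_trans ff; rewrite le_eqVlt; apply/orP; left; apply/eqP.
by apply: eq_integral => x _; rewrite gee0_abs// lee_fin sqr_ge0.
Qed.

(** One construction yields both operators needed on the circle: $g=\bar\xi$ gives the adjoint of
    $M_\xi$, and $g=1/(1-z\bar\xi)$ gives the inverse [Rz]. *)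
Lemma multiplication_op : 0 <= M -> exists G : {linear L2 mu -> L2 mu},
  (forall f : L2fun mu, G (L2class f) = L2mk (mul_sqint f)) /\
  (forall u, `|G u| <= M%:C%C * `|u|).
Proof.
move=> M0.
pose G0 (u : L2 mu) : L2 mu := L2mk (mul_sqint (L2repr u)).
(* [G0] multiplies a chosen representative; any other one agrees with it almost everywhere, so the
   class of the product is the same. *)
have G0E (f : L2fun mu) : G0 (L2class f) = L2mk (mul_sqint f).
  by apply/L2class_eqP; apply: filterS (L2repr_class f) => x /= ->.
have G0_linear : linear G0.
  move=> a u v; rewrite -[u]L2reprK -[v]L2reprK.
  set p := L2repr u; set q := L2repr v.
  rewrite -[a *: L2class p]L2classZ -L2classD !G0E /L2mk -[a *: _]L2classZ -L2classD.
  congr L2class; apply/val_inj/funext => x.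
  by rewrite /= !fctE /= mulrDr /GRing.scale /= mulrCA.
have [G GE] := linear_exists _ _ _ G0_linear.
exists G; split=> [f|u]; first by rewrite GE.
rewrite GE -[u]L2reprK; set f := L2repr u.
pose h : L2fun mu := exist (fun k : T -> R[i]^o => k \in sqint mu) _ (mul_sqint f).
rewrite G0E -[L2mk _]/(L2class h).
rewrite -(@ler_pXn2r _ 2)// ?nnegrE ?mulr_ge0// ?lecR// exprMn !L2norm_sqr.
rewrite !L2dot_self -rmorphXn -rmorphM lecR /= -RintegralZl//; last exact: integrable_sqr.
apply: le_Rintegral => //.
- exact: (integrable_sqr h).
- have := integrableZl measurableT (M ^+ 2) (integrable_sqr f).
  by apply: eq_integrable.
Qed.

End Multiplication.

Lemma L2class_ext d (T : measurableType d) (R : realType)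
    (mu : {measure set T -> \bar R}) (f h : L2fun mu) :
  (forall x, val f x = val h x) -> L2class f = L2class h.
Proof. by move=> fh; congr L2class; apply/val_inj/funext. Qed.

(** * Operators on the circle and their Cauchy transforms *)

Section CircleOperators.
Context (R : realType) (mu : probability (circle R) R).
Implicit Types z : R[i].

Lemma xi_conjK (x : circle R) : xi x * (xi x)^* = 1.
Proof. by rewrite -normCK norm_xi expr1n. Qed.

Lemma xi_sub_neq0 z (x : circle R) : `|z| < 1 -> xi x - z != 0.
Proof.
move=> z1; rewrite subr_eq0; apply/eqP => xz.
by move: z1; rewrite -xz norm_xi ltxx.
Qed.

(* The right-hand side is a rational function of [xi x], so that its
   measurability does not involve continuity of the conjugation. *)
Lemma resolventE z (x : circle R) : `|z| < 1 ->
  (1 - (xi x)^* * z)^-1 = xi x / (xi x - z).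
Proof.
move=> z1; have x0 : xi x != 0 by rewrite -normr_gt0 norm_xi.
rewrite -[RHS]invf_div; congr GRing.inv.
by rewrite mulrBl divff// [z / _]mulrC -(mulr1 (xi x)^-1) -(xi_conjK x) mulKf.
Qed.

Lemma one_sub_conj_neq0 z (x : circle R) : `|z| < 1 -> 1 - (xi x)^* * z != 0.
Proof.
move=> z1; rewrite -invr_eq0 resolventE// mulf_neq0 ?invr_eq0 ?xi_sub_neq0//.
by rewrite -normr_gt0 norm_xi.
Qed.

(** Continuity is asked only at points of the circle, because the function $w/(w-z)$ to be used has
    a pole at $z$ inside the disc. *)
Lemma continuous_measurable_comp_xi (f : R[i]^o -> R[i]^o) :
  (forall x : circle R, {for xi x, continuous f}) ->
  measurable_fun setT (fun x : circle R => complex.Re (f (xi x))) /\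
  measurable_fun setT (fun x : circle R => complex.Im (f (xi x))).
Proof.
move=> cf; split.
  apply: (@continuous_measurable_circle _ (@complex.Re R \o (f \o set_val))) => x.
  apply: (@continuous_comp _ R[i]^o R); last exact: Re_continuous.
  by apply: continuous_comp; [exact: initial_continuous|exact: cf].
apply: (@continuous_measurable_circle _ (@complex.Im R \o (f \o set_val))) => x.
apply: (@continuous_comp _ R[i]^o R); last exact: Im_continuous.
by apply: continuous_comp; [exact: initial_continuous|exact: cf].
Qed.

Lemma measurable_resolvent z : `|z| < 1 ->
  measurable_fun setT (fun x : circle R => complex.Re (1 - (xi x)^* * z)^-1) /\
  measurable_fun setT (fun x : circle R => complex.Im (1 - (xi x)^* * z)^-1).
Proof.
move=> z1.
under eq_fun do rewrite resolventE//.
under [X in _ /\ measurable_fun _ X]eq_fun do rewrite resolventE//.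
apply: (continuous_measurable_comp_xi (fun w => w / (w - z))) => x.
apply: (@continuousM R[i] R[i]^o id (fun w => (w - z)^-1)); first exact: cvg_id.
apply: (@continuousV R[i] R[i]^o (fun w => w - z)); first exact: xi_sub_neq0.
apply: (@continuousB R[i] R[i]^o R[i]^o id (cst z)); first exact: cvg_id.
exact: cst_continuous.
Qed.

(** $|1-\bar\xi z|\ge 1-|z|$, since $|\xi|=1$. *)
Lemma normc_resolvent_le z (x : circle R) : `|z| < 1 ->
  ComplexField.Normc.normc (1 - (xi x)^* * z)^-1 <=
  (1 - ComplexField.Normc.normc z)^-1.
Proof.
move=> z1; have z1' : ComplexField.Normc.normc z < 1 by rewrite -ltcR.
rewrite ComplexField.Normc.normcV lef_pV2 ?posrE ?subr_gt0//; last first.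
  rewrite -ltcR -[ltLHS]/(0 : R[i]) -[ltRHS]/(`|1 - (xi x)^* * z| : R[i]).
  by rewrite normr_gt0 one_sub_conj_neq0.
rewrite -lecR rmorphB /= -[leRHS]/(`|1 - (xi x)^* * z| : R[i]).
rewrite -[leLHS]/(1 - `|z| : R[i]).
apply: le_trans (lerB_normD _ _).
by rewrite normrN normrM norm_conjC norm_xi normr1 mul1r.
Qed.

Let xibarF : L2fun mu :=
  exist (fun f : circle R -> R[i]^o => f \in sqint mu) _ (xibar_sqint mu).
Let oneF : L2fun mu :=
  exist (fun f : circle R -> R[i]^o => f \in sqint mu) _ (one_sqint mu).

Lemma Mxi_xibar : Mxi (L2xibar mu) = L2one mu.
Proof.
rewrite -[L2xibar mu]/(L2class xibarF) Mxi_class.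
by congr L2class; apply/val_inj/funext => x /=; exact: xi_conjK.
Qed.

Lemma dot_xibar : L2dot (L2xibar mu) (L2xibar mu) = 1.
Proof.
rewrite [LHS](L2dotE xibarF xibarF) /= /Cintegral.
under eq_Rintegral do rewrite conjCK mulrC xi_conjK.
under [X in (_ +i* X)%C]eq_Rintegral do rewrite conjCK mulrC xi_conjK.
by rewrite /= !Rintegral_cst//= mul0r probability_setT mulr1.
Qed.

(** Supplies the hypotheses of the rank-one computation: [W] is multiplication by $\bar\xi$ and [Rz]
    multiplication by $1/(1-\bar\xi z)$, of norm at most $1/(1-|z|)$. The inner product of [Rz]
    applied to $\bar\xi$ with the constant 1 is the integral defining $K(\bar\xi\mu)(z)$. *)
Lemma Mxi_inverse : exists W : {linear L2 mu -> L2 mu},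
  [/\ cancel (@Mxi R mu) W, cancel W (@Mxi R mu),
      forall u v, L2dot (Mxi u) v = L2dot u (W v) &
      forall z, `|z| < 1 -> exists (Rz : {linear L2 mu -> L2 mu}) (M : R[i]),
      [/\ forall u, Rz u - z *: W (Rz u) = u,
          forall u, Rz (u - z *: W u) = u,
          forall u, `|Rz u| <= M * `|u| &
          L2dot (Rz (L2xibar mu)) (L2one mu) =
            cauchy_transform mu (fun x => (xi x)^*) z]].
Proof.
have [m1 m2] := measurable_xi R.
have mJ1 : measurable_fun setT (fun x : circle R => complex.Re (xi x)^*).
  by apply: eq_measurable_fun m1 => x _; case: (xi x).
have mJ2 : measurable_fun setT (fun x : circle R => complex.Im (xi x)^*).
  have ImJ (w : R[i]) : complex.Im w^* = - complex.Im w by case: w.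
  by under eq_fun do rewrite ImJ; exact: measurable_funN.
have J1 (x : circle R) : ComplexField.Normc.normc (xi x)^* <= 1.
  by rewrite -lecR -[leLHS]/(`|(xi x)^*| : R[i]) norm_conjC norm_xi.
have [W [WE _]] := multiplication_op _ _ _ mu _ _ mJ1 mJ2 J1 ler01.
exists W; split.
- move=> u; rewrite -[u]L2reprK Mxi_class /L2mk WE.
  by apply: L2class_ext => x /=; rewrite mulrA [_^* * _]mulrC xi_conjK mul1r.
- move=> u; rewrite -[u]L2reprK WE /L2mk Mxi_class.
  by apply: L2class_ext => x /=; rewrite mulrA xi_conjK mul1r.
- move=> u v; rewrite -[u]L2reprK -[v]L2reprK Mxi_class WE /L2mk !L2dotE /=.
  congr (Cintegral mu _); apply/funext => x.
  by rewrite rmorphM /= conjCK mulrCA mulrA.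
move=> z z1; have [r1 r2] := measurable_resolvent z z1.
have M0 : 0 <= (1 - ComplexField.Normc.normc z)^-1.
  by rewrite invr_ge0 subr_ge0 ltW// -ltcR.
have [Rz [RzE RzM]] := multiplication_op _ _ _ mu _ _ r1 r2
  (fun x => normc_resolvent_le z x z1) M0.
exists Rz, ((1 - ComplexField.Normc.normc z)^-1)%:C%C; split => //.
- move=> u; apply/eqP; rewrite subr_eq -[u]L2reprK RzE /L2mk WE /L2mk.
  rewrite -[_ *: L2class _]L2classZ -L2classD; apply/eqP/L2class_ext => x /=.
  rewrite !fctE -[z *: _]/(z * _).
  by have D := one_sub_conj_neq0 z x z1; field.
- move=> u; apply/eqP; rewrite (linearB Rz) (linearZ_LR Rz) /= subr_eq.
  rewrite -[u]L2reprK WE /L2mk !RzE /L2mk.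
  rewrite -[_ *: L2class _]L2classZ -L2classD; apply/eqP/L2class_ext => x /=.
  rewrite !fctE -[z *: _]/(z * _).
  by have D := one_sub_conj_neq0 z x z1; field.
- rewrite -[L2xibar mu]/(L2class xibarF) -[L2one mu]/(L2class oneF) RzE /L2mk L2dotE /=.
  by congr (Cintegral mu _); apply/funext => x; rewrite conjC1 mulr1 mulrC.
Qed.

(** Integrate $1/(1-\bar\xi z)=1+z\bar\xi/(1-\bar\xi z)$ against $\mu$, which has mass 1. *)
Lemma cauchy_transform1 z : `|z| < 1 ->
  cauchy_transform mu (fun=> 1) z =
  1 + z * cauchy_transform mu (fun x => (xi x)^*) z.
Proof.
move=> z1; have [r1 r2] := measurable_resolvent z z1.
(* $\bar\xi/(1-\bar\xi z)$ as a square-integrable function; its integrability follows by pairing it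
   with the constant 1. *)
pose F : L2fun mu := exist (fun f : circle R -> R[i]^o => f \in sqint mu) _
  (mul_sqint _ _ _ mu _ _ r1 r2 (fun x => normc_resolvent_le z x z1) xibarF).
have iF := sqint_mul F oneF; have i1 := sqint_mul oneF oneF.
rewrite /cauchy_transform.
have -> : (fun x : circle R => 1 / (1 - (xi x)^* * z)) =
   (fun x => val oneF x * (val oneF x)^* + z * (val F x * (val oneF x)^*)).
  apply/funext => x /=; rewrite conjC1 !mulr1.
  by have D := one_sub_conj_neq0 z x z1; field.
rewrite CintegralD//; last first.
  have := sqint_mul (z *: F) oneF; congr Cintegrable.
  by apply/funext => x; rewrite mulrA.
rewrite CintegralZ//; congr (_ + z * _).
  rewrite -[LHS]/(Cintegral mu (fun=> 1 * 1^*)) conjC1 mulr1 /Cintegral /=.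
  by rewrite !Rintegral_cst//= mul0r probability_setT mulr1.
by congr (Cintegral mu _); apply/funext => x /=; rewrite conjC1 mulr1 mulrC.
Qed.

End CircleOperators.

(** * The scalar characteristic function in terms of Cauchy transforms *)

Theorem theorem5p1 (R : realType) (mu : probability (circle R) R)
    (beta z : R[i]) (hbeta : `|beta| < 1) (hz : `|z| < 1) :
  scalar_char_fun mu beta z =
    - beta + z * (1 - `|beta| ^+ 2) *
      (cauchy_transform mu (fun x => (xi x)^*) z /
       (cauchy_transform mu (fun=> 1) z -
        z * beta^* * cauchy_transform mu (fun x => (xi x)^*) z)).
Proof.
have [W [VK WK VW /(_ z hz)[Rz [M [RzK KRz RzM kE]]]]] := Mxi_inverse R mu.
have b1 := dot_xibar R mu.
(* Writing $\mathbf{1}_\xi=M_\xi\bar\xi$ puts the operator in the form $Vu+(\beta-1)(u,b)Vb$. *)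
have XE : Uhat beta = (fun u : L2 mu => Mxi u +
    ((beta - 1) * L2dot u (L2xibar mu)) *: Mxi (L2xibar mu)).
  by apply/funext => u; rewrite Mxi_xibar.
rewrite cauchy_transform1// -kE; set k := L2dot (Rz _) _.
(* This turns the denominator of the statement into the Sherman-Morrison denominator. *)
rewrite (_ : 1 + z * k - _ = 1 - z * (beta^* - 1) * k); last by ring.
set c0 := (X in _ = X).
have ran_xibar :
    closure (range (defect (@L2dot _ _ _ mu) (Uhat beta))) (L2xibar mu).
  rewrite XE.
  exact: (closure_range_defect _ (@L2norm_sqr _ _ _ mu) _ _ _ _ VK WK VW b1).
have charE (v : closure (range (defect (@L2dot _ _ _ mu) (Uhat beta)))) :
    set_val v = L2xibar mu ->
    char_op_fun (@L2dot _ _ _ mu) (Uhat beta) z v = c0 *: L2one mu.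
  (* The type of [v] mentions the operator, so [v] must be generalized before the operator is
     rewritten. *)
  move: v; rewrite XE /c0 /k -Mxi_xibar => v vb.
  exact: (char_op_fun_perturbation _ (@L2norm_sqr _ _ _ mu) _ _ _ _ VK WK VW b1
    hbeta _ _ _ hz RzK KRz RzM).
(* [c0] shows that the set is nonempty, so [get] returns some [c] with
   [c *: L2one mu = c0 *: L2one mu]; then [c = c0] because the constant 1 has norm 1 and is
   therefore nonzero. *)
rewrite /scalar_char_fun; set P := (X in xget _ X).
have [v [/charE ->]] : P (get P).
  by apply: getPex; exists c0, (SigSub (mem_set ran_xibar)); split; rewrite ?charE.
move=> /eqP; rewrite -subr_eq0 -scalerBl scaler_eq0 subr_eq0 => /orP[/eqP//|/eqP e0].
have : L2dot (L2one mu) (L2one mu) = 1 by rewrite -Mxi_xibar VW VK.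
by rewrite e0 (linear0l (@L2dot _ _ _ mu)) => /esym/eqP; rewrite oner_eq0.
Qed.
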